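(* Let $\mathbb{G}$ be a finite quantum group and let $\nu,\mu\in M_p(\mathbb{G})$ be states supported on a quasi-subgroup $\mathbb{S}$ of $\mathbb{G}$. Then $\nu\star\mu$ is also supported on $\mathbb{S}$.
   Context: A finite quantum group $\mathbb{G}$ is given by its algebra of functions $F(\mathbb{G})$: a finite-dimensional unital $\mathrm{C}^*$-algebra with a $*$-homomorphism (comultiplication) $\Delta:F(\mathbb{G})\to F(\mathbb{G})\otimes F(\mathbb{G})$, a counit $\varepsilon$ and an antipode $S$ making $(F(\mathbb{G}),\Delta,S,\varepsilon)$ a Hopf $*$-algebra. Its unit is $\mathds{1}_{\mathbb{G}}$. $2^{\mathbb{G}}$ denotes the set of projections ($p=p^*=p^2$) in $F(\mathbb{G})$, and $M_p(\mathbb{G})$ the set of states (positive linear functionals $\mu$ with $\mu(\mathds{1}_{\mathbb{G}})=1$) on $F(\mathbb{G})$. The convolution of states is $\nu\star\mu:=(\nu\otimes\mu)\Delta$. A group-like projection is a non-zero $p\in 2^{\mathbb{G}}$ with $\Delta(p)(\mathds{1}_{\mathbb{G}}\otimes p)=p\otimes p$. To a group-like projection one associates a (virtual) quasi-subgroup $\mathbb{S}\subseteq\mathbb{G}$ and writes the projection as $\mathds{1}_{\mathbb{S}}$. A state $\nu$ is supported on a quasi-subgroup $\mathbb{S}$ if $\nu(\mathds{1}_{\mathbb{S}})=1$. *)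

(* Defs.v *)
From HB Require Import structures.
From mathcomp Require Import all_boot all_order all_algebra all_field.
From mathcomp Require Import complex reals ring.
Set Implicit Arguments.
Unset Strict Implicit.
Unset Printing Implicit Defensive.
Import Order.TTheory GRing.Theory Num.Theory.
Local Open Scope ring_scope.

(* [t : tensor U V] stands for \sum_i \sum_j t i j *: (e_i \ox f_j), where e and
   f are the bases [vbasis {:U}] and [vbasis {:V}]. [tlift_tens] and [tensor_ext]
   give the universal property, so the choice of bases is immaterial. *)

Definition tensor (K : fieldType) (U V : vectType K) : Type :=
  'M[K]_(\dim {:U}, \dim {:V}).

HB.instance Definition _ (K : fieldType) (U V : vectType K) :=
  Vector.copy (tensor U V) 'M[K]_(\dim {:U}, \dim {:V}).

Section Tensor.
Variable K : fieldType.
Implicit Types U V W : vectType K.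

Local Notation bas U := (vbasis (fullv : {vspace U})).

Definition tens U V (u : U) (v : V) : tensor U V :=
  \matrix_(i, j) (coord (bas U) i u * coord (bas V) j v).

Local Notation "u '\ox' v" := (tens u v) (at level 40, left associativity).

(* The linear map on U \ox V induced by a bilinear map b on U x V. *)
Definition tlift U V (W : lmodType K) (b : U -> V -> W) (t : tensor U V) : W :=
  \sum_i \sum_j (t : 'M_(_, _)) i j *: b (bas U)`_i (bas V)`_j.

Lemma tlift_is_linear U V (W : lmodType K) (b : U -> V -> W) :
  linear (tlift b).
Proof.
move=> a s t; rewrite /tlift scaler_sumr -big_split; apply: eq_bigr => i _ /=.
rewrite scaler_sumr -big_split; apply: eq_bigr => j _ /=.
by rewrite !mxE scalerDl scalerA.
Qed.
HB.instance Definition _ U V (W : lmodType K) (b : U -> V -> W) :=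
  GRing.isLinear.Build K (tensor U V) W *:%R (tlift b) (tlift_is_linear b).

Lemma tens_is_linear_r U V (u : U) : linear (@tens U V u).
Proof. by move=> a v w; apply/matrixP=> i j; rewrite !mxE linearP /=; ring. Qed.
HB.instance Definition _ U V (u : U) :=
  GRing.isLinear.Build K V (tensor U V) *:%R (@tens U V u) (tens_is_linear_r u).

Lemma tens_is_linear_l U V (v : V) : linear (fun u : U => u \ox v).
Proof. by move=> a u w; apply/matrixP=> i j; rewrite !mxE linearP /=; ring. Qed.

Lemma linear_comb (U W : lmodType K) (f : U -> W) (flin : linear f)
    (I : Type) (r : seq I) (a : I -> K) (x : I -> U) :
  f (\sum_(i <- r) a i *: x i) = \sum_(i <- r) a i *: f (x i).
Proof.
pose F : {linear U -> W} := HB.pack f (GRing.isLinear.Build K U W *:%R f flin).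
by rewrite -[f]/(F : U -> W) linear_sum; apply: eq_bigr => i _; rewrite linearZ.
Qed.

Lemma coord_bas U (u : U) : u = \sum_i coord (bas U) i u *: (bas U)`_i.
Proof. exact: coord_vbasis (memvf u). Qed.

Lemma tlift_tens U V (W : lmodType K) (b : U -> V -> W) :
    (forall u, linear (b u)) -> (forall v, linear (b ^~ v)) ->
  forall u v, tlift b (u \ox v) = b u v.
Proof.
move=> br bl u v; rewrite {2}(coord_bas u).
rewrite (linear_comb (bl v)); apply: eq_bigr => i _.
rewrite {2}(coord_bas v) (linear_comb (br _)) scaler_sumr.
by apply: eq_bigr => j _; rewrite mxE scalerA.
Qed.

Lemma tensor_bas U V (t : tensor U V) :
  t = \sum_i \sum_j (t : 'M_(_, _)) i j *: ((bas U)`_i \ox (bas V)`_j).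
Proof.
rewrite {1}[t]matrix_sum_delta; apply: eq_bigr => i _; apply: eq_bigr => j _.
congr (_ *: _); apply/matrixP=> k l; rewrite !mxE.
rewrite !coord_free ?(basis_free (vbasisP _)) //.
by rewrite [i == k]eq_sym [j == l]eq_sym -natrM mulnb.
Qed.

Lemma tensor_ext U V (W : lmodType K) (f g : tensor U V -> W) :
    linear f -> linear g ->
  (forall u v, f (u \ox v) = g (u \ox v)) -> forall t, f t = g t.
Proof.
move=> fl gl fg t; rewrite (tensor_bas t) pair_big /=.
rewrite (linear_comb fl _ (fun p => t p.1 p.2)).
rewrite (linear_comb gl _ (fun p => t p.1 p.2)).
by apply: eq_bigr => p _; rewrite fg.
Qed.

Lemma tlift_linear_param (X : lmodType K) U V (W : lmodType K)
    (b : X -> U -> V -> W) (t : tensor U V) :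
  (forall u v, linear (fun x => b x u v)) -> linear (fun x => tlift (b x) t).
Proof.
move=> bl a x y; rewrite /tlift scaler_sumr -big_split; apply: eq_bigr => i _.
rewrite /= scaler_sumr -big_split; apply: eq_bigr => j _ /=.
by rewrite bl scalerDr !scalerA mulrC.
Qed.

Definition tmap U V U' V' (f : U -> U') (g : V -> V') :
  tensor U V -> tensor U' V' := tlift (fun u v => f u \ox g v).

Definition tassoc U V W : tensor (tensor U V) W -> tensor U (tensor V W) :=
  tlift (fun t w => tlift (fun u v => u \ox (v \ox w)) t).

Lemma tmap_tens U V U' V' (f : {linear U -> U'}) (g : {linear V -> V'}) u v :
  tmap f g (u \ox v) = f u \ox g v.
Proof.
apply: tlift_tens => [x|y] a w z; first by rewrite !linearP.
by rewrite linearP tens_is_linear_l.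
Qed.

Lemma tassoc_tens U V W (u : U) (v : V) (w : W) :
  tassoc (u \ox v \ox w) = u \ox (v \ox w).
Proof.
rewrite /tassoc tlift_tens ?tlift_tens //.
- by move=> x a y z; rewrite tens_is_linear_l linearP.
- by move=> x a y z; rewrite tens_is_linear_l.
- move=> t; apply: tlift_linear_param => x y a w1 w2.
  by rewrite !linearP.
- by move=> w'; apply: tlift_is_linear.
Qed.

End Tensor.

Notation "u '\ox' v" := (tens u v) (at level 40, left associativity) : ring_scope.

(* Lemma [tens_mul]: the product is (a \ox b) * (c \ox d) = (a * c) \ox (b * d). *)

Section TensorAlgebra.
Variables (K : fieldType) (A B : falgType K).
Implicit Types s t r : tensor A B.

Definition tensor_mul s t : tensor A B :=
  tlift (fun a b => tlift (fun c d => (a * c) \ox (b * d)) t) s.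

Lemma tensor_mul_linear_l t : linear (tensor_mul ^~ t).
Proof. exact: tlift_is_linear. Qed.

Lemma tensor_mul_linear_r s : linear (tensor_mul s).
Proof.
apply: tlift_linear_param => a b; exact: tlift_is_linear.
Qed.

Lemma tensor_mul_tens (a c : A) (b d : B) :
  tensor_mul (a \ox b) (c \ox d) = (a * c) \ox (b * d).
Proof.
rewrite /tensor_mul tlift_tens ?tlift_tens //.
- by move=> x k y z; rewrite mulrDr -scalerAr linearP.
- by move=> x k y z; rewrite mulrDr -scalerAr tens_is_linear_l.
- move=> x; apply: tlift_linear_param => u v k y z.
  by rewrite mulrDl -scalerAl linearP.
- move=> x; apply: tlift_linear_param => u v k y z.
  by rewrite mulrDl -scalerAl tens_is_linear_l.
Qed.

Lemma tensor_mulA : associative tensor_mul.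
Proof.
move=> s t r; move: s.
apply: tensor_ext => [k x y|k x y|a b].
- by rewrite tensor_mul_linear_l.
- by rewrite !tensor_mul_linear_l.
move: t; apply: tensor_ext => [k x y|k x y|c d].
- by rewrite tensor_mul_linear_l tensor_mul_linear_r.
- by rewrite tensor_mul_linear_r tensor_mul_linear_l.
move: r; apply: tensor_ext => [k x y|k x y|e f].
- by rewrite !tensor_mul_linear_r.
- by rewrite tensor_mul_linear_r.
by rewrite !tensor_mul_tens !mulrA.
Qed.

Lemma tensor_mul1l : left_id (1 \ox 1) tensor_mul.
Proof.
apply: tensor_ext => [||a b]; [exact: tensor_mul_linear_r | by [] |].
by rewrite tensor_mul_tens !mul1r.
Qed.

Lemma tensor_mul1r : right_id (1 \ox 1) tensor_mul.
Proof.
apply: tensor_ext => [||a b]; [exact: tensor_mul_linear_l | by [] |].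
by rewrite tensor_mul_tens !mulr1.
Qed.

Lemma tensor_mulDl : left_distributive tensor_mul +%R.
Proof.
by move=> s t r; have := tensor_mul_linear_l r 1 s t; rewrite !scale1r.
Qed.

Lemma tensor_mulDr : right_distributive tensor_mul +%R.
Proof.
by move=> r s t; have := tensor_mul_linear_r r 1 s t; rewrite !scale1r.
Qed.

Lemma tensor_one_neq0 : (1 \ox 1 : tensor A B) != 0.
Proof.
have nz (C : falgType K) : exists i, coord (vbasis {:C}) i 1 != 0.
  apply/existsP; apply: contraTT isT => /existsPn /= h; exfalso.
  have /eqP := oner_neq0 C; apply; rewrite (coord_bas 1) big1 // => i _.
  by move/negbNE/eqP: (h i) => ->; rewrite scale0r.
have [[i hi] [j hj]] := (nz A, nz B).
apply/eqP => /matrixP /(_ i j); rewrite !mxE => /eqP.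
by rewrite mulf_eq0 (negPf hi) (negPf hj).
Qed.

HB.instance Definition _ :=
  GRing.Zmodule_isNzRing.Build (tensor A B) tensor_mulA tensor_mul1l
    tensor_mul1r tensor_mulDl tensor_mulDr tensor_one_neq0.

Lemma tensor_scalerAl (k : K) s t : k *: (s * t) = (k *: s) * t.
Proof.
have := tensor_mul_linear_l t k s 0.
by rewrite addr0 [X in _ + X](mul0r t) addr0 => /esym.
Qed.

HB.instance Definition _ :=
  GRing.Lmodule_isLalgebra.Build K (tensor A B) tensor_scalerAl.

Lemma tensor_scalerAr (k : K) s t : k *: (s * t) = s * (k *: t).
Proof.
have := tensor_mul_linear_r s k t 0.
by rewrite addr0 [X in _ + X](mulr0 s) addr0 => /esym.
Qed.

HB.instance Definition _ :=
  GRing.Lalgebra_isAlgebra.Build K (tensor A B) tensor_scalerAr.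
HB.instance Definition _ := Algebra_isFalgebra.Build K (tensor A B).

Lemma tens_mul (a c : A) (b d : B) :
  (a \ox b) * (c \ox d) = (a * c) \ox (b * d).
Proof. exact: tensor_mul_tens. Qed.

Lemma tens_one : 1 \ox 1 = 1 :> tensor A B. Proof. by []. Qed.

End TensorAlgebra.

(* Finite-dimensional C*-algebras: completeness is automatic in finite dimension,
   and so are the (total) inverses that [falgType] asks for.
   [ComplexField.Normc.normc] is the modulus of R[i] with values in R. *)

HB.mixin Record isCstarAlgebra (R : realType) A of Falgebra R[i] A := {
  star : A -> A;
  starD : forall x y : A, star (x + y) = star x + star y;
  starZ : forall (a : R[i]) (x : A), star (a *: x) = a^* *: star x;
  starM : forall x y : A, star (x * y) = star y * star x;
  starK : forall x : A, star (star x) = x;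
  cstar_norm : A -> R;
  cstar_norm_eq0 : forall x : A, cstar_norm x = 0 -> x = 0;
  cstar_normD : forall x y : A,
    cstar_norm (x + y) <= cstar_norm x + cstar_norm y;
  cstar_normZ : forall (a : R[i]) (x : A),
    cstar_norm (a *: x) = ComplexField.Normc.normc a * cstar_norm x;
  cstar_normM : forall x y : A,
    cstar_norm (x * y) <= cstar_norm x * cstar_norm y;
  cstar_identity : forall x : A,
    cstar_norm (star x * x) = cstar_norm x ^+ 2
}.

#[short(type="cstarAlgType")]
HB.structure Definition CstarAlgebra (R : realType) :=
  { A of Falgebra R[i] A & isCstarAlgebra R A }.

Arguments star {R s} x : rename.

Section CstarTensor.
Variables (R : realType) (A B : cstarAlgType R).

(* The antilinear involution with (a \ox b)^* = a^* \ox b^*, written on a basis. *)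
Definition tensor_star (t : tensor A B) : tensor A B :=
  \sum_i \sum_j ((t : 'M_(_, _)) i j)^* *:
    (star (vbasis {:A})`_i \ox star (vbasis {:B})`_j).

Lemma star0 (C : cstarAlgType R) : star 0 = 0 :> C.
Proof. by rewrite -(scale0r (0 : C)) starZ conjC0 !scale0r. Qed.

Lemma star_sum (C : cstarAlgType R) (I : Type) (r : seq I) (P : pred I)
    (x : I -> C) :
  star (\sum_(i <- r | P i) x i) = \sum_(i <- r | P i) star (x i).
Proof. exact: (big_morph _ (@starD _ C) (star0 C)). Qed.

Lemma star1 (C : cstarAlgType R) : star 1 = 1 :> C.
Proof. by rewrite -[LHS]mul1r -{1}(starK 1) -starM mul1r starK. Qed.

Lemma tensor_star_tens (a : A) (b : B) :
  tensor_star (a \ox b) = star a \ox star b.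
Proof.
have starE (C : cstarAlgType R) (c : C) :
    star c = \sum_i (coord (vbasis {:C}) i c)^* *: star (vbasis {:C})`_i.
  rewrite {1}(coord_bas c) star_sum.
  by apply: eq_bigr => i _; rewrite starZ.
rewrite (starE A a) (starE B b).
rewrite (linear_comb (@tens_is_linear_l _ A B _)); apply: eq_bigr => i _.
rewrite (linear_comb (@tens_is_linear_r _ A B _)) scaler_sumr.
by apply: eq_bigr => j _; rewrite mxE rmorphM scalerA.
Qed.

Lemma tensor_starD (s t : tensor A B) :
  tensor_star (s + t) = tensor_star s + tensor_star t.
Proof.
rewrite /tensor_star -big_split; apply: eq_bigr => i _ /=.
rewrite -big_split; apply: eq_bigr => j _ /=.
by rewrite mxE rmorphD scalerDl.
Qed.

End CstarTensor.

(* [F] is the algebra of functions F(G). The coalgebra and antipode axioms use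
   the identifications R[i] \ox F = F = F \ox R[i] and the multiplication map
   through [tlift]: [counitl] is (eps \ox id) Delta = id and [antipodel] is
   m (S \ox id) Delta = eps(.) 1. *)
Record finQuantumGroup (R : realType) := FinQuantumGroup {
  F : cstarAlgType R;
  comul : {lrmorphism F -> tensor F F};
  counit : {lrmorphism F -> R[i] | *%R};
  antipode : {linear F -> F};
  comul_star : forall a, comul (star a) = tensor_star (comul a);
  coassoc : forall a,
    tassoc (tmap comul idfun (comul a)) = tmap idfun comul (comul a);
  counitl : forall a, tlift (fun x y : F => counit x *: y) (comul a) = a;
  counitr : forall a, tlift (fun x y : F => counit y *: x) (comul a) = a;
  antipodel : forall a,
    tlift (fun x y : F => antipode x * y) (comul a) = counit a *: 1;
  antipoder : forall a,
    tlift (fun x y : F => x * antipode y) (comul a) = counit a *: 1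
}.

Definition is_projection (R : realType) (A : cstarAlgType R) (p : A) : Prop :=
  star p = p /\ p * p = p.

(* A quasi-subgroup S of G is given by its group-like projection 1_S. *)
Record quasiSubgroup (R : realType) (G : finQuantumGroup R) := QuasiSubgroup {
  qs_indicator : F G;
  qs_projection : is_projection qs_indicator;
  qs_neq0 : qs_indicator != 0;
  qs_group_like :
    comul G qs_indicator * (1 \ox qs_indicator) = qs_indicator \ox qs_indicator
}.

Record state (R : realType) (G : finQuantumGroup R) := State {
  state_fun :> {scalar (F G)};
  state_pos : forall a : F G, 0 <= state_fun (star a * a);
  state_one : state_fun 1 = 1
}.

Lemma psd_decomp (C : numClosedFieldType) n (M : 'M[C]_n) :
    (forall i j, M j i = (M i j)^*) ->
    (forall c : 'I_n -> C, 0 <= \sum_i \sum_j (c i)^* * c j * M i j) ->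
  exists (d : 'I_n -> C) (P : 'M[C]_n), (forall k, 0 <= d k) /\
    forall i j, M i j = \sum_k d k * ((P k i)^* * P k j).
Proof.
move=> Mh Mp.
have Mherm : M \is hermsymmx.
  apply/is_hermitianmxP; rewrite expr0 scale1r; apply/matrixP => i j.
  by rewrite !mxE Mh.
pose P := spectralmx M; pose D := spectral_diag M.
have Pu : P \is unitarymx := spectral_unitarymx M.
have ME : M = (map_mx Num.conj P^T) *m diag_mx D *m P.
  rewrite -invmx_unitary //.
  by have /hermitian_normalmx /orthomx_spectralP := Mherm.
have DE : diag_mx D = P *m M *m (map_mx Num.conj P^T).
  rewrite ME -invmx_unitary // !mulmxA mulmxK ?unitarymx_unit //.
  by rewrite mulmxV ?unitarymx_unit // mul1mx.
exists (D 0), P; split => [k|i j].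
  have /matrixP/(_ k k) := DE; rewrite !mxE eqxx mulr1n => ->.
  have := Mp (fun i => (P k i)^*); rewrite exchange_big /=.
  congr (_ <= _); apply: eq_bigr => j _; rewrite !mxE mulr_suml.
  by apply: eq_bigr => i _; rewrite conjCK; ring.
rewrite {1}ME !mxE; apply: eq_bigr => k _; rewrite mul_mx_diag !mxE; ring.
Qed.

Section Positivity.
Variable R : realType.

Definition positive (A : cstarAlgType R) (f : A -> R[i]) : Prop := forall a, 0 <= f (star a * a).

Lemma positive_herm (A : cstarAlgType R) (f : {scalar A}) : positive f ->
  forall a b, f (star b * a) = (f (star a * b))^*.
Proof.
move=> fpos a b.
have fre c : (f (star c * c))^* = f (star c * c).
  by apply/CrealP; exact: ger0_real.
have e1 := fre (a + b); have e2 := fre (a + 'i *: b).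
set x := f (star a * b); set y := f (star b * a).
have h1 : f (star (a + b) * (a + b)) = f (star a * a) + f (star b * b) + (x + y).
  by rewrite starD mulrDl !mulrDr !raddfD /= -/x -/y; ring.
have h2 : f (star (a + 'i *: b) * (a + 'i *: b)) =
    f (star a * a) + f (star b * b) + 'i * (x - y).
  rewrite starD starZ conjCi mulrDl !mulrDr -!scalerAl -!scalerAr !raddfD /=.
  rewrite !scalarZ -/x -/y.
  have i2 := sqrCi R[i]. ring: i2.
move: e1 e2; rewrite h1 h2 !rmorphD rmorphM rmorphB /= !fre conjCi.
move=> /addrI e1 /addrI e2.
have {}e2 : y^* - x^* = x - y.
  by apply: (mulfI (neq0Ci R[i])); rewrite -e2; ring.
apply: (mulfI (_ : 2%:R != 0 :> R[i])); first by rewrite pnatr_eq0.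
have -> : 2%:R * x^* = (x^* + y^*) - (y^* - x^*) by ring.
by rewrite e1 e2; ring.
Qed.

Lemma scalar_star_sum (A : cstarAlgType R) (f : {scalar A}) n
    (c : 'I_n -> R[i]) (x : 'I_n -> A) :
  f (star (\sum_i c i *: x i) * (\sum_i c i *: x i)) =
  \sum_i \sum_j (c i)^* * c j * f (star (x i) * x j).
Proof.
rewrite star_sum mulr_suml linear_sum; apply: eq_bigr => i _.
rewrite mulr_sumr linear_sum; apply: eq_bigr => j _.
by rewrite starZ -scalerAl -scalerAr !scalarZ mulrA.
Qed.

Definition tensor_fun (A B : cstarAlgType R) (f : A -> R[i]) (g : B -> R[i])
  (t : tensor A B) : R[i] := tlift (fun x y => f x * g y : R[i]^o) t.

Lemma tensor_fun_is_scalar (A B : cstarAlgType R) (f : A -> R[i])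
  (g : B -> R[i]) : scalar (@tensor_fun A B f g).
Proof. exact: tlift_is_linear. Qed.
HB.instance Definition _ (A B : cstarAlgType R) (f : A -> R[i]) (g : B -> R[i]) :=
  GRing.isLinear.Build R[i] (tensor A B) R[i] *%R (@tensor_fun A B f g)
    (@tensor_fun_is_scalar A B f g).

Lemma tensor_fun_tens (A B : cstarAlgType R) (f : {scalar A}) (g : {scalar B})
  a b : tensor_fun f g (a \ox b) = f a * g b.
Proof.
apply: tlift_tens => x k y z; rewrite linearP /=.
  by rewrite /GRing.scale /=; ring.
by rewrite /GRing.scale /=; ring.
Qed.

Lemma tensor_fun_positive (A B : cstarAlgType R) (f : {scalar A})
    (g : {scalar B}) : positive f -> positive g ->
  forall t, 0 <= tensor_fun f g (tensor_star t * t).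
Proof.
move=> fpos gpos t.
pose e (j : 'I_(\dim {:B})) := (vbasis {:B})`_j.
pose a (j : 'I_(\dim {:B})) := \sum_i (t : 'M_(_, _)) i j *: (vbasis {:A})`_i.
have tE : t = \sum_j a j \ox e j.
  rewrite {1}(tensor_bas t) exchange_big; apply: eq_bigr => j _ /=.
  by rewrite (linear_comb (@tens_is_linear_l _ A B _)).
have tsE : tensor_star t = \sum_j star (a j) \ox star (e j).
  have ts0 : tensor_star (0 : tensor A B) = 0.
    rewrite /tensor_star big1 // => i _; rewrite big1 // => j _.
    by rewrite mxE conjC0 scale0r.
  rewrite {1}tE (big_morph _ (@tensor_starD _ A B) ts0).
  by apply: eq_bigr => j _; rewrite tensor_star_tens.
have [||d [P [d0 gE]]] := @psd_decomp R[i] (\dim {:B})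
    (\matrix_(i, j) g (star (e i) * e j)).
- by move=> i j; rewrite !mxE (positive_herm gpos).
- move=> c; suff -> : \sum_i \sum_j (c i)^* * c j *
      (\matrix_(i, j) g (star (e i) * e j)) i j =
    g (star (\sum_i c i *: e i) * (\sum_i c i *: e i)) by exact: gpos.
  rewrite scalar_star_sum; apply: eq_bigr => i _; apply: eq_bigr => j _.
  by rewrite mxE.
have {}gE i j : g (star (e i) * e j) = \sum_k d k * ((P k i)^* * P k j).
  by rewrite -gE mxE.
suff -> : tensor_fun f g (tensor_star t * t) = \sum_k d k *
    f (star (\sum_j P k j *: a j) * (\sum_j P k j *: a j)).
  by apply: sumr_ge0 => k _; rewrite mulr_ge0.
under eq_bigr do rewrite scalar_star_sum mulr_sumr.
rewrite [RHS]exchange_big /=.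
rewrite tsE {1}tE mulr_suml linear_sum; apply: eq_bigr => i _ /=.
under [RHS]eq_bigr do rewrite mulr_sumr.
rewrite mulr_sumr linear_sum [RHS]exchange_big; apply: eq_bigr => j _ /=.
rewrite tens_mul tensor_fun_tens gE mulr_sumr.
by apply: eq_bigr => k _; ring.
Qed.

End Positivity.

Section Convolution.
Variables (R : realType) (G : finQuantumGroup R).
Implicit Types nu mu : state G.

Definition convol_fun nu mu (a : F G) : R[i] := tensor_fun nu mu (comul G a).

Lemma convol_is_scalar nu mu : scalar (convol_fun nu mu).
Proof. by move=> k a b; rewrite /convol_fun !linearP. Qed.
HB.instance Definition _ nu mu :=
  GRing.isLinear.Build R[i] (F G) R[i] *%R (convol_fun nu mu)
    (convol_is_scalar nu mu).

Lemma convol_pos nu mu a : 0 <= convol_fun nu mu (star a * a).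
Proof.
rewrite /convol_fun rmorphM /= comul_star.
apply: tensor_fun_positive => b; exact: state_pos.
Qed.

Lemma convol_one nu mu : convol_fun nu mu 1 = 1.
Proof.
by rewrite /convol_fun rmorph1 -tens_one tensor_fun_tens !state_one mulr1.
Qed.

(* nu \star mu = (nu \ox mu) Delta, bundled with the proof that it is a state. *)
Definition convol nu mu : state G :=
  State (state_fun := convol_fun nu mu) (convol_pos nu mu) (convol_one nu mu).

Definition supported_on nu (S : quasiSubgroup G) : Prop :=
  nu (qs_indicator S) = 1.

End Convolution.

Notation "nu '\star' mu" := (convol nu mu)
  (at level 40, left associativity) : ring_scope.

(* Main.v *)
Require Import Defs.
From mathcomp Require Import all_boot all_order all_algebra all_field complex reals.
From mathcomp Require Import ring.
Import Order.TTheory GRing.Theory Num.Theory.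
Local Open Scope ring_scope.

(** Let [p] be the group-like projection of the quasi-subgroup and [q = 1 - p]
its complement, so that [mu q = 0]. By the Cauchy-Schwarz inequality a positive
functional that vanishes on [star b * b] vanishes on the whole left ideal
generated by [b] ([positive_null_ideal]). Hence [mu] kills every [x * q], that
is, [mu (x * p) = mu x] ([state_mul_support]), and on the tensor square
[nu \ox mu] does not see right multiplication by [1 \ox p]
([tensor_fun_mul_support]). Applied to [comul p], this replaces [comul p] by
[comul p * (1 \ox p)], which is [p \ox p] since [p] is group-like, and
[nu \ox mu] takes the value [nu p * mu p = 1] there. *)

(** This is the degenerate case of the Cauchy-Schwarz inequality: if
[z := f (star a * b)] were non-zero, then the value of [f] at
[star (a - s z^* b) * (a - s z^* b)], which is [f (star a * a) - 2 s |z|^2],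
would become negative for large [s]. *)
Lemma positive_null_ideal (R : realType) (A : cstarAlgType R) (f : {scalar A}) :
  positive f -> forall b, f (star b * b) = 0 -> forall x, f (x * b) = 0.
Proof.
move=> fpos b fb0 x; rewrite -(starK x); move: (star x) => a.
set z := f (star a * b).
have zc : f (star b * a) = z^* by exact: positive_herm.
have [//|z0] := eqVneq z 0; exfalso.
have [s sE] : {s | s = (f (star a * a) + 1) / (2%:R * (z * z^*))} by eexists.
have sr : s^* = s.
  apply/CrealP/ger0_real; rewrite sE divr_ge0 // ?addr_ge0 ?fpos //.
  by rewrite mulr_ge0 // mul_conjC_ge0.
have := fpos (a + (- (s * z^*)) *: b).
rewrite starD starZ mulrDl !mulrDr -!scalerAl -!scalerAr !raddfD /= !scalarZ.
rewrite -/z zc fb0 rmorphN rmorphM /= conjCK sr.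
(* The parameter [s] was chosen to make this value exactly [-1]. *)
have -> : f (star a * a) + - (s * z^*) * z +
    (- (s * z) * z^* + - (s * z) * (- (s * z^*) * 0)) = -1.
  by rewrite sE; field; rewrite z0 conjC_eq0 z0.
by rewrite oppr_ge0 ler10.
Qed.

Lemma state_mul_support (R : realType) (G : finQuantumGroup R) (mu : state G)
    (p : F G) :
  is_projection p -> mu p = 1 -> forall x, mu (x * p) = mu x.
Proof.
move=> [ps pp] mup x; apply/eqP; rewrite eq_sym -subr_eq0; apply/eqP.
rewrite -raddfB -{1}(mulr1 x) -mulrBr.
apply: positive_null_ideal => [a|]; first exact: state_pos.
have -> : star (1 - p) * (1 - p) = 1 - p.
  rewrite -scaleN1r starD starZ star1 ps rmorphN rmorph1 scaleN1r.
  by rewrite mulrBr mulr1 mulrBl mul1r pp subrr subr0.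
by rewrite raddfB /= mup state_one subrr.
Qed.

Lemma tensor_fun_mul_support (R : realType) (G : finQuantumGroup R)
    (nu mu : state G) (p : F G) :
  is_projection p -> mu p = 1 ->
  forall t, tensor_fun nu mu (t * (1 \ox p)) = tensor_fun nu mu t.
Proof.
move=> pproj mup.
apply: (tensor_ext (W := R[i]^o)) => [k s t|k s t|x y].
- by rewrite mulrDl -scalerAl linearP.
- by rewrite linearP.
by rewrite tens_mul mulr1 !tensor_fun_tens state_mul_support.
Qed.

Theorem proposition3p12 (R : realType) (G : finQuantumGroup R)
  (S : quasiSubgroup G) (nu mu : state G) :
  supported_on nu S -> supported_on mu S -> supported_on (nu \star mu) S.
Proof.
rewrite /supported_on /= /convol_fun => nuS muS.
rewrite -(tensor_fun_mul_support _ _ nu _ _ (qs_projection S) muS).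
by rewrite qs_group_like tensor_fun_tens nuS muS mulr1.
Qed.
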